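(* Let $l(x,z)$ and $m(x,z)$ be smooth functions on an open set $D\subseteq\mathbb{R}^2$ satisfying the system $$\frac{\partial^3 l}{\partial x^3}-3\,l\,\frac{\partial l}{\partial x}+\frac{\partial l}{\partial z}=0,$$ $$\frac{\partial l}{\partial x}-\frac{\partial m}{\partial z}+2\,\frac{\partial l}{\partial x}\,m+l\,\frac{\partial m}{\partial x}=0 .$$ Then the three-dimensional metric $$ds^2=y^2\,dx^2+2\left(l(x,z)\,y^2+m(x,z)\right)dx\,dz+2\,dy\,dz+\left(l(x,z)^2y^2-2\,\frac{\partial l}{\partial x}(x,z)\,y+2\,l(x,z)\,m(x,z)+2\,l(x,z)\right)dz^2$$ on $\{(x,y,z): (x,z)\in D,\ y\neq 0\}$ is flat, i.e. its Riemann curvature tensor satisfies $R_{ijkl}=0$.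
   Context: A metric written as $ds^2=g_{ij}\,dx^i dx^j$ means the symmetric tensor with components $g_{ij}$ (so $2f\,dx\,dz$ contributes $g_{xz}=g_{zx}=f$); metrics may be pseudo-Riemannian (indefinite). $R_{ijkl}$ is the Riemann curvature tensor of the Levi-Civita connection of $g$. *)

(* Defs.v *)
From HB Require Import structures.
From mathcomp Require Import all_boot all_order all_algebra.
From mathcomp Require Import all_classical all_reals all_analysis.
From mathcomp Require Import ring.

Set Implicit Arguments.
Unset Strict Implicit.
Unset Printing Implicit Defensive.

Import Order.TTheory GRing.Theory Num.Theory.
Import numFieldNormedType.Exports.

Local Open Scope classical_set_scope.
Local Open Scope ring_scope.

Section Calculus.
Context {R : realType} {n : nat}.
Implicit Types (D : set 'rV[R]_n) (f : 'rV[R]_n -> R) (i : 'I_n).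

Definition pderiv i f : 'rV[R]_n -> R := fun p => 'D_(delta_mx 0 i) f p.

(* Meant for open D, so that the values of f outside D play no role. *)
Fixpoint Ck_on (r : nat) D f : Prop :=
  (forall p, D p -> {for p, continuous f}) /\
  if r is r'.+1 then
    forall i, (forall p, D p -> derivable f p (delta_mx 0 i)) /\
              Ck_on r' D (pderiv i f)
  else True.

Definition smooth_on D f : Prop := forall r, Ck_on r D f.

End Calculus.

Section Curvature.
Context {R : realType} {n : nat}.
Implicit Types (g : 'rV[R]_n -> 'M[R]_n) (p : 'rV[R]_n) (i j k l a : 'I_n).

(* Gamma_{aij} = (d_i g_{aj} + d_j g_{ai} - d_a g_{ij}) / 2 *)
Definition christoffel1 g a i j p : R :=
  (pderiv i (fun q => g q a j) p + pderiv j (fun q => g q a i) p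
   - pderiv a (fun q => g q i j) p) / 2.

(* Gamma^k_{ij}: the coefficients of the Levi-Civita connection in the
   coordinate frame, nabla_{d_i} d_j = Gamma^k_{ij} d_k; see
   [christoffelC] (no torsion) and [christoffel_compat] (nabla g = 0).
   Meaningful where the matrix of g is invertible. *)
Definition christoffel g k i j p : R :=
  \sum_a invmx (g p) k a * christoffel1 g a i j p.

(* R^i_{jkl} = d_k Gamma^i_{lj} - d_l Gamma^i_{kj}
               + Gamma^i_{ka} Gamma^a_{lj} - Gamma^i_{la} Gamma^a_{kj},
   i.e. R(d_k, d_l) d_j = R^i_{jkl} d_i. *)
Definition riemann_up g i j k l p : R :=
  pderiv k (christoffel g i l j) p - pderiv l (christoffel g i k j) p
  + \sum_a (christoffel g i k a p * christoffel g a l j p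
            - christoffel g i l a p * christoffel g a k j p).

Definition riemann g i j k l p : R :=
  \sum_a g p i a * riemann_up g a j k l p.

Definition flat_on (U : set 'rV[R]_n) g : Prop :=
  forall p, U p -> forall i j k l, riemann g i j k l p = 0.

Lemma christoffelC g k i j p :
  (forall q, (g q)^T = g q) -> christoffel g k i j p = christoffel g k j i p.
Proof.
move=> sg; apply: eq_bigr => a _; rewrite /christoffel1.
have -> : (fun q => g q i j) = (fun q => g q j i).
  by apply/funext => q; rewrite -{1}sg mxE.
by rewrite (addrC (pderiv i _ p)).
Qed.

Lemma christoffel_compat g k i j p :
  (forall q, (g q)^T = g q) -> g p \in unitmx ->
  pderiv k (fun q => g q i j) p =
  \sum_a (christoffel g a k i p * g p a j + christoffel g a k j p * g p i a).
Proof.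
move=> sg ug.
have gC a b q : g q a b = g q b a by rewrite -{1}sg mxE.
have dC a b c : pderiv c (fun q => g q a b) p = pderiv c (fun q => g q b a) p.
  by congr (pderiv c _ p); apply/funext => q.
have lower b c d : \sum_a g p b a * christoffel g a c d p
    = christoffel1 g b c d p.
  transitivity (((g p *m (invmx (g p) *m \col_a christoffel1 g a c d p))) b 0).
    rewrite mxE; apply: eq_bigr => a _; congr (_ * _).
    by rewrite mxE; apply: eq_bigr => e _; rewrite mxE.
  by rewrite mulmxA mulmxV // mul1mx mxE.
rewrite big_split /=.
under eq_bigr do rewrite mulrC gC.
under [X in _ = _ + X]eq_bigr do rewrite mulrC.
rewrite !lower /christoffel1 (dC j k) (dC j i) (dC i k).
by field.
Qed.

End Curvature.

Section Metric.
Context {R : realType}.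
Implicit Types (l m : 'rV[R]_2 -> R) (p : 'rV[R]_3).

(* Coordinates: the plane carries (x, z) = (q 0 0, q 0 1) and the space
   (x, y, z) = (p 0 0, p 0 1, p 0 2). *)
Definition xz p : 'rV[R]_2 := \row_(j < 2) [:: p 0 0; p 0 2]`_j.

Definition kdv_metric l m p : 'M[R]_3 :=
  let y := p 0 1 in
  let q := xz p in
  let gxz := l q * y ^+ 2 + m q in
  let gzz := l q ^+ 2 * y ^+ 2 - 2 * pderiv 0 l q * y
             + 2 * l q * m q + 2 * l q in
  \matrix_(i, j)
    (nth [::] [:: [:: y ^+ 2; 0; gxz];
                  [:: 0;      0; 1  ];
                  [:: gxz;    1; gzz]] i)`_j.

Lemma kdv_metric_sym l m p : (kdv_metric l m p)^T = kdv_metric l m p.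
Proof. by apply/matrixP => -[[|[|[|]]]// ?] [[|[|[|]]]// ?]; rewrite !mxE. Qed.

Lemma kdv_metric_unit l m p : p 0 1 != 0 -> kdv_metric l m p \in unitmx.
Proof.
move=> y0; rewrite unitmxE unitfE.
suff -> : \det (kdv_metric l m p) = - p 0 1 ^+ 2 by rewrite oppr_eq0 expf_neq0.
rewrite (expand_det_row _ 1) !big_ord_recl big_ord0 /cofactor.
rewrite !(expand_det_row _ 0) !big_ord_recl !big_ord0 /cofactor !det_mx11.
rewrite !mxE /= /bump /=.
ring.
Qed.

End Metric.

(* Main.v *)
(* All first and second derivatives of the metric are polynomials in y, 1/y and
   the x-derivatives of l and m: the system expresses l_z and m_z through
   x-derivatives, and so, mixed partials being equal, it expresses every
   d_z d_x^k l and d_z d_x^k m as well.  Each R^i_{jkl} thus becomes a rational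
   expression in y and finitely many independent quantities d_x^k l, d_x^k m,
   and this expression vanishes identically. *)
Require Import Defs.
From mathcomp Require Import all_boot all_order all_algebra.
From mathcomp Require Import all_classical all_reals all_analysis.
From mathcomp Require Import ring.

Set Implicit Arguments.
Unset Strict Implicit.
Unset Printing Implicit Defensive.

Import Order.TTheory GRing.Theory Num.Theory.
Import numFieldNormedType.Exports.

Local Open Scope classical_set_scope.
Local Open Scope ring_scope.

(** * Directional derivatives along affine lines *)

(** As [g] is affine along [u], the two difference quotients agree for every [h]. Derivability and
    the value of the derivative therefore transfer together, without a chain rule for total
    differentials. *)
Lemma growth_rate_comp_line (R : numFieldType) (U V W : normedModType R)
    (g : U -> V) (f : V -> W) (a u : U) (v : V) :
  (forall h, g (h *: u + a) = h *: v + g a) ->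
  (fun h => h^-1 *: ((f \o g \o shift a) (h *: u) - (f \o g) a)) =
  (fun h => h^-1 *: ((f \o shift (g a)) (h *: v) - f (g a))).
Proof. by move=> gE; apply/funext => h /=; rewrite gE. Qed.

Lemma derivable_comp_line (R : numFieldType) (U V W : normedModType R)
    (g : U -> V) (f : V -> W) (a u : U) (v : V) :
  (forall h, g (h *: u + a) = h *: v + g a) ->
  derivable f (g a) v -> derivable (f \o g) a u.
Proof. by move=> gE; rewrite /derivable (growth_rate_comp_line _ gE). Qed.

Lemma derive_comp_line (R : numFieldType) (U V W : normedModType R)
    (g : U -> V) (f : V -> W) (a u : U) (v : V) :
  (forall h, g (h *: u + a) = h *: v + g a) ->
  'D_u (f \o g) a = 'D_v f (g a).
Proof. by move=> gE; rewrite /derive (growth_rate_comp_line _ gE). Qed.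

Lemma is_derive_line (R : numFieldType) (V W : normedModType R)
    (f : V -> W) (a v : V) (t : R) :
  derivable f (t *: v + a) v ->
  is_derive t 1 (fun s => f (s *: v + a)) ('D_v f (t *: v + a)).
Proof.
have gE h : (h *: (1 : R) + t) *: v + a = h *: v + (t *: v + a).
  by rewrite scalerDl addrA [h *: 1]mulr1.
move=> df; split; first exact: (derivable_comp_line gE df).
exact: (derive_comp_line f gE).
Qed.

(** * Symmetry of mixed directional derivatives *)

Section MixedDerivatives.
Context {R : realType} {V : normedModType R}.
Implicit Types (f : V -> R) (p u v : V) (h : R).

Lemma MVT_line f p v h : 0 < h ->
  (forall t, 0 <= t <= h -> derivable f (t *: v + p) v) ->
  exists2 t, 0 <= t <= h & f (h *: v + p) - f p = 'D_v f (t *: v + p) * h.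
Proof.
move=> h0 df.
have dF t : t \in `[0, h] ->
    is_derive t 1 (fun s => f (s *: v + p)) ('D_v f (t *: v + p)).
  by rewrite in_itv => /df; exact: is_derive_line.
have dF' t : t \in `]0, h[ ->
    is_derive t 1 (fun s => f (s *: v + p)) ('D_v f (t *: v + p)).
  by move=> th; apply: dF; apply: subset_itv_oo_cc th.
have cF : {within `[0, h], continuous (fun s => f (s *: v + p))}.
  by apply: derivable_within_continuous => t /dF[].
have [t] := MVT_segment (ltW h0) dF' cF.
rewrite in_itv /= scale0r add0r subr0 => th fE.
by exists t.
Qed.

(* The left-hand side is symmetric in u and v. *)
Lemma second_difference f p u v h : 0 < h ->
  (forall s t, 0 <= s <= h -> 0 <= t <= h ->
     derivable f (s *: u + (t *: v + p)) u /\
     derivable ('D_u f) (s *: u + (t *: v + p)) v) ->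
  exists s t, [/\ 0 <= s <= h, 0 <= t <= h &
    f (h *: u + (h *: v + p)) - f (h *: u + p) - (f (h *: v + p) - f p)
    = 'D_v ('D_u f) (s *: u + (t *: v + p)) * h * h].
Proof.
move=> h0 df.
have hh : 0 <= h <= h by rewrite lexx ltW.
have h00 : (0 : R) <= 0 <= h by rewrite lexx ltW.
(* The second difference is the increment of [g] along [u]. The mean value theorem is applied first
   to [g] along [u], then to ['D_u f] along [v]. *)
pose g q := f (h *: v + q) - f q.
have dg s : 0 <= s <= h -> is_derive (s *: u + p) u g
    ('D_u f (s *: u + (h *: v + p)) - 'D_u f (s *: u + p)).
  move=> sh.
  have [dfh _] := df s h sh hh; have [df0 _] := df s 0 sh h00.
  rewrite scale0r add0r in df0.
  have gE k : h *: v + (k *: u + (s *: u + p)) =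
    k *: u + (h *: v + (s *: u + p)) by rewrite addrCA.
  rewrite addrCA in dfh *.
  apply: is_deriveB.
    split; first exact: (derivable_comp_line gE dfh).
    exact: (derive_comp_line f gE).
  exact: derivableP.
have [s sh gE] := MVT_line h0 (fun s sh => let: DeriveDef d _ := dg s sh in d).
have [|t th fE] := @MVT_line ('D_u f) (s *: u + p) v h h0.
  by move=> t th; rewrite addrCA; have [] := df s t sh th.
have [_ dgE] := dg s sh; rewrite {}dgE in gE.
exists s, t; split; [exact: sh|exact: th|].
rewrite (addrCA (s *: u) (t *: v) p) -fE (addrCA (h *: v) (s *: u) p).
by rewrite -gE /g (addrCA (h *: u) (h *: v) p).
Qed.

(** Schwarz's theorem: on a small box at [p], both mixed derivatives take, at suitable points, the
    value of the same second difference divided by [h * h]. Continuity at [p] then makes their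
    values at [p] differ by less than any [e]. *)
Lemma deriveC f p u v :
  (\forall q \near p, [/\ derivable f q u, derivable f q v,
     derivable ('D_u f) q v & derivable ('D_v f) q u]) ->
  {for p, continuous ('D_v ('D_u f))} -> {for p, continuous ('D_u ('D_v f))} ->
  'D_v ('D_u f) p = 'D_u ('D_v f) p.
Proof.
move=> df cvu cuv; apply/eqP; rewrite -subr_eq0 -normr_le0.
apply/ler_addgt0Pr => e e0; rewrite add0r.
have e20 : 0 < e / 2 by rewrite divr_gt0.
pose Q q := [/\ derivable f q u, derivable f q v,
     derivable ('D_u f) q v & derivable ('D_v f) q u] /\
     (`|'D_v ('D_u f) p - 'D_v ('D_u f) q| < e / 2 /\
      `|'D_u ('D_v f) p - 'D_u ('D_v f) q| < e / 2).
have near_p : \forall q \near p, Q q.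
  apply: filterI => //; apply: filterI.
    by move/cvgrPdist_lt : cvu; apply.
  by move/cvgrPdist_lt : cuv; apply.
(* A small enough parallelogram spanned by [u] and [v] at [p] stays in the neighbourhood where [Q]
   holds. *)
have cbox : (fun st : R * R => st.1 *: u + (st.2 *: v + p)) @ (0, 0) --> p.
  have pE : 0 *: u + (0 *: v + p) = p by rewrite !scale0r !add0r.
  rewrite -{2}pE; apply: cvgD.
    by apply: cvgZ; [exact: cvg_fst|exact: cvg_cst].
  apply: cvgD; last exact: cvg_cst.
  by apply: cvgZ; [exact: cvg_snd|exact: cvg_cst].
have [[A B] /= [A0 B0] box] := cbox _ near_p.
have /nbhs_ballP[d /= d0 AB] : nbhs (0 : R) (A `&` B) by exact: filterI.
(* Halving [d] puts the closed interval from 0 to [h] inside the open ball of radius [d]. *)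
pose h := d / 2.
have h0 : 0 < h by rewrite divr_gt0.
have near0 s : 0 <= s <= h -> (A `&` B) s.
  move=> /andP[s0 sh]; apply: AB; rewrite /ball /= sub0r normrN ger0_norm//.
  by rewrite (le_lt_trans sh)// /h ltr_pdivrMr// ltr_pMr// ltr1n.
have {}box s t : 0 <= s <= h -> 0 <= t <= h -> Q (s *: u + (t *: v + p)) :=
  fun sh th => box (s, t) (conj (near0 s sh).1 (near0 t th).2).
have [s t sh th|s [t [sh th fE]]] := @second_difference f p u v h h0.
  by have [[d1 _ d2 _] _] := box s t sh th; exact: conj d1 d2.
have [s' t' sh' th'|s' [t' [sh' th' fE']]] := @second_difference f p v u h h0.
  have [[_ d1 _ d2] _] := box t' s' th' sh'.
  by rewrite addrCA; exact: conj d1 d2.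
(* Exchanging [u] and [v] only permutes the four terms of the second difference. *)
have {fE fE'} : 'D_v ('D_u f) (s *: u + (t *: v + p)) * h * h =
    'D_u ('D_v f) (s' *: v + (t' *: u + p)) * h * h.
  have subC (a b c d' : R) : a - b - (c - d') = a - c - (b - d') by ring.
  apply: etrans (esym fE) (etrans _ fE').
  by rewrite (addrCA (h *: v) (h *: u) p); exact: subC.
have hn0 : h != 0 by rewrite gt_eqF.
move=> /(mulIf hn0)/(mulIf hn0).
have [_ [Apq _]] := box s t sh th; have [_ [_ Bpq]] := box t' s' th' sh'.
rewrite (addrCA (s' *: v) (t' *: u) p) => pqE.
(* The two intermediate points may differ, but the mixed derivatives there have a common value,
   which serves as midpoint in the triangle inequality. *)
rewrite pqE in Apq; rewrite distrC in Bpq.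
apply: le_trans (ler_distD _ _ _) _; apply: ltW.
by rewrite (splitr e); exact: ltrD Apq Bpq.
Qed.

End MixedDerivatives.

(** * Partial derivatives of smooth functions *)

Section SmoothOn.
Context {R : realType} {n : nat}.
Implicit Types (D : set 'rV[R]_n.+1) (f : 'rV[R]_n.+1 -> R) (i j : 'I_n.+1).

Lemma smooth_on_continuous D f p : smooth_on D f -> D p -> {for p, continuous f}.
Proof. by move=> /(_ 0%N)[cf _]; exact: cf. Qed.

Lemma smooth_on_derivable D f p i :
  smooth_on D f -> D p -> derivable f p (delta_mx 0 i).
Proof. by move=> /(_ 1%N)[_ /(_ i)[df _]]; exact: df. Qed.

Lemma smooth_on_pderiv D f i : smooth_on D f -> smooth_on D (pderiv i f).
Proof. by move=> sf r; have [_ /(_ i)[]] := sf r.+1. Qed.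

Lemma smooth_on_iter_pderiv D f i k :
  smooth_on D f -> smooth_on D (iter k (pderiv i) f).
Proof. by move=> sf; elim: k => // k; exact: smooth_on_pderiv. Qed.

Lemma pderivC D f p i j : open D -> smooth_on D f -> D p ->
  pderiv j (pderiv i f) p = pderiv i (pderiv j f) p.
Proof.
move=> oD sf Dp; have s2 a b := smooth_on_pderiv b (smooth_on_pderiv a sf).
apply: deriveC; last 2 first.
- exact: smooth_on_continuous (s2 i j) Dp.
- exact: smooth_on_continuous (s2 j i) Dp.
have /filterS : \forall q \near p, D q by exact: open_nbhs_nbhs.
apply=> q Dq; split.
- exact: smooth_on_derivable sf Dq.
- exact: smooth_on_derivable sf Dq.
- exact: smooth_on_derivable (smooth_on_pderiv i sf) Dq.
- exact: smooth_on_derivable (smooth_on_pderiv j sf) Dq.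
Qed.

End SmoothOn.

Lemma eq_pderiv (R : realType) (n : nat) (U : set 'rV[R]_n.+1)
    (f g : 'rV[R]_n.+1 -> R) (i : 'I_n.+1) p :
  open U -> {in U, f =1 g} -> U p -> pderiv i f p = pderiv i g p.
Proof.
move=> oU fg Up; apply: near_eq_derive.
have /filterS : \forall q \near p, U q by exact: open_nbhs_nbhs.
by apply=> q Uq; apply: fg; exact: mem_set.
Qed.

Lemma is_derive_coord (R : realType) (n : nat) (i : 'I_n.+1) (p v : 'rV[R]_n.+1) :
  is_derive p v (fun q => q 0 i) (v 0 i).
Proof.
have gE h : (h *: v + p) 0 i = h *: v 0 i + p 0 i by rewrite !mxE.
have [did dE] := is_derive_id (p 0 i) (v 0 i).
by split; [exact: (derivable_comp_line gE did)|rewrite (derive_comp_line id gE)].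
Qed.

(** * Pullback of functions of (x, z) to space *)

Section PullbackXZ.
Context {R : realType}.
Implicit Types (f : 'rV[R]_2 -> R) (p u : 'rV[R]_3).

Lemma xz_line p u h : xz (h *: u + p) = h *: xz u + xz p.
Proof. by apply/rowP => -[[|[|]]// ?]; rewrite !mxE. Qed.

Lemma xz_delta_x : xz (delta_mx 0 0) = delta_mx 0 0 :> 'rV[R]_2.
Proof. by apply/rowP => -[[|[|]]// ?]; rewrite !mxE. Qed.

Lemma xz_delta_y : xz (delta_mx 0 1) = 0 :> 'rV[R]_2.
Proof. by apply/rowP => -[[|[|]]// ?]; rewrite !mxE. Qed.

Lemma xz_delta_z : xz (delta_mx 0 2) = delta_mx 0 1 :> 'rV[R]_2.
Proof. by apply/rowP => -[[|[|]]// ?]; rewrite !mxE. Qed.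

Lemma is_derive_xz f p u :
  derivable f (xz p) (xz u) -> is_derive p u (f \o xz) ('D_(xz u) f (xz p)).
Proof.
have gE h := xz_line p u h.
by split; [exact: (derivable_comp_line gE)|exact: (derive_comp_line f gE)].
Qed.

Lemma continuous_xz : continuous (@xz R).
Proof.
(* Balls are entrywise and each entry of [xz q] is an entry of [q], so the same radius works. *)
move=> p A /nbhs_ballP[e /= e0 eA]; apply/nbhs_ballP; exists e => // q [_ pq].
by apply: eA; split => // i [[|[|]]// ?]; rewrite !mxE; exact: pq.
Qed.


End PullbackXZ.

(** * Formal jets and their derivations *)

(* Formal polynomials in y, 1/y, 1/2 and the x-derivatives L k = d_x^k l,
   M k = d_x^k m. *)
Inductive jet :=
  | Y | Yinv | L of nat | M of nat | Cst of nat | Half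
  | Opp of jet | Add of jet & jet | Mul of jet & jet.

(* The derivation taking the values y, dL k, dM k at Y, L k, M k. *)
Fixpoint jet_der (y : jet) (dL dM : nat -> jet) (e : jet) : jet :=
  let d := jet_der y dL dM in
  match e with
  | Y => y
  | Yinv => Opp (Mul y (Mul Yinv Yinv))
  | L k => dL k
  | M k => dM k
  | Cst _ | Half => Cst 0
  | Opp a => Opp (d a)
  | Add a b => Add (d a) (d b)
  | Mul a b => Add (Mul (d a) b) (Mul a (d b))
  end.

Definition jet_dx := jet_der (Cst 0) (fun k => L k.+1) (fun k => M k.+1).

Definition jet_dy := jet_der (Cst 1) (fun=> Cst 0) (fun=> Cst 0).

(* l_z and m_z as given by the system. *)
Definition jet_lz := Add (Mul (Cst 3) (Mul (L 0) (L 1))) (Opp (L 3)).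

Definition jet_mz :=
  Add (L 1) (Add (Mul (Cst 2) (Mul (L 1) (M 0))) (Mul (L 0) (M 1))).

(** The values at [L k] and [M k] build in both the system and the commutation of d_z with d_x^k. *)
Definition jet_dz := jet_der (Cst 0)
  (fun k => iter k jet_dx jet_lz) (fun k => iter k jet_dx jet_mz).

Definition jet_pderiv := nth id [:: jet_dx; jet_dy; jet_dz].

(** The derivatives enter as arbitrary sequences, so that identities can be proved with all of them
    as free variables. *)
Fixpoint jet_val (R : fieldType) (y : R) (l m : nat -> R) (e : jet) : R :=
  match e with
  | Y => y
  | Yinv => y^-1
  | L k => l k
  | M k => m k
  | Cst c => c%:R
  | Half => 2^-1
  | Opp a => - jet_val y l m a
  | Add a b => jet_val y l m a + jet_val y l m b
  | Mul a b => jet_val y l m a * jet_val y l m b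
  end.

Definition jet_eval (R : realType) (l m : 'rV[R]_2 -> R) (e : jet)
    (p : 'rV[R]_3) : R :=
  jet_val (p 0 1) (fun k => iter k (pderiv 0) l (xz p))
    (fun k => iter k (pderiv 0) m (xz p)) e.

(** A derivation is determined by its values on the generators, so induction on [e] reduces the
    claim to these. The rule for [Yinv] is the derivative of 1/y, valid where y is nonzero. *)
Lemma is_derive_jet_der (R : realType) (l m : 'rV[R]_2 -> R) (p v : 'rV[R]_3)
    (y : jet) (dL dM : nat -> jet) (e : jet) :
  p 0 1 != 0 ->
  v 0 1 = jet_eval l m y p ->
  (forall k, is_derive p v (jet_eval l m (L k)) (jet_eval l m (dL k) p)) ->
  (forall k, is_derive p v (jet_eval l m (M k)) (jet_eval l m (dM k) p)) ->
  is_derive p v (jet_eval l m e) (jet_eval l m (jet_der y dL dM e) p).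
Proof.
move=> y0 yE dlE dmE; have dY := is_derive_coord 1 p v.
move: dlE dmE yE; rewrite /jet_eval => dlE dmE yE; elim: e => //=.
- by rewrite -yE.
- have [dY1 dYE] := dY; split; first exact: derivableV.
  by rewrite deriveV// dYE yE /GRing.scale/= -exprVn expr2 mulNr mulrC.
- by move=> c; exact: is_derive_cst.
- exact: is_derive_cst.
- by move=> a da; exact: is_deriveN.
- by move=> a da b db; exact: is_deriveD.
- move=> a da b db; apply: is_derive_eq; rewrite addrC /GRing.scale/=.
  by congr (_ + _); rewrite mulrC.
Qed.

(** * Formal derivations compute the partial derivatives *)

Section JetCalculus.
Context {R : realType} {D : set 'rV[R]_2} {l m : 'rV[R]_2 -> R}.
Context (oD : open D) (sl : smooth_on D l) (sm : smooth_on D m).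
Context (lE : forall q, D q ->
  pderiv 0 (pderiv 0 (pderiv 0 l)) q - 3 * l q * pderiv 0 l q
  + pderiv 1 l q = 0).
Context (mE : forall q, D q ->
  pderiv 0 l q - pderiv 1 m q + 2 * pderiv 0 l q * m q
  + l q * pderiv 0 m q = 0).

Let U := [set p : 'rV[R]_3 | D (xz p) /\ p 0 1 != 0].
Let ev := jet_eval l m.

(** Openness allows identities that hold on [U] to be differentiated there. *)
Lemma open_metric_domain : open U.
Proof.
apply: openI; first by apply: open_comp => // p _; exact: continuous_xz.
apply: (@open_comp _ _ (fun p : 'rV[R]_3 => p 0 1) [set y | y != 0]).
  by move=> p _; exact: coord_continuous.
exact: open_neq.
Qed.

Lemma pderiv_xz (f : 'rV[R]_2 -> R) p :
  pderiv 0 (f \o @xz R) p = pderiv 0 f (xz p).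
Proof.
have gE h := xz_line p (delta_mx 0 0) h.
by rewrite /pderiv (derive_comp_line f gE) xz_delta_x.
Qed.

Lemma is_derive_jet_dx p e : U p ->
  is_derive p (delta_mx 0 0) (ev e) (ev (jet_dx e) p).
Proof.
have dxE f k : smooth_on D f -> U p -> is_derive p (delta_mx 0 0)
    (iter k (pderiv 0) f \o @xz R) (iter k.+1 (pderiv 0) f (xz p)).
  move=> sf [Dp _]; have := @is_derive_xz R (iter k (pderiv 0) f) p (delta_mx 0 0).
  rewrite xz_delta_x; apply.
  exact: smooth_on_derivable (smooth_on_iter_pderiv _ _ sf) Dp.
move=> Up; apply: is_derive_jet_der; first by case: Up.
- by rewrite mxE.
- by move=> k; exact: dxE.
- by move=> k; exact: dxE.
Qed.

(* d_z commutes with d_x^k, so the formula for f_z may be differentiated in x. *)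
Lemma pderiv_z_iter (f : 'rV[R]_2 -> R) (fz : jet) :
  smooth_on D f -> {in U, (fun p => pderiv 1 f (xz p)) =1 ev fz} ->
  forall k, {in U, (fun p => pderiv 1 (iter k (pderiv 0) f) (xz p))
                   =1 ev (iter k jet_dx fz)}.
Proof.
move=> sf fzE; elim=> [//|k IHk] p /set_mem Up; have [Dp _] := Up.
have sfk := smooth_on_iter_pderiv 0 k sf.
(* The outer x-derivative is moved from the plane to space, because the induction hypothesis is an
   identity between functions on [U]. *)
rewrite iterS -(pderivC 1 0 oD sfk Dp) -pderiv_xz.
rewrite (eq_pderiv _ open_metric_domain IHk Up) /pderiv.
by have [_ ->] := is_derive_jet_dx (iter k jet_dx fz) Up.
Qed.

Lemma is_derive_jet_dz p e : U p ->
  is_derive p (delta_mx 0 2) (ev e) (ev (jet_dz e) p).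
Proof.
have dzE f fz k : smooth_on D f -> {in U, (fun p => pderiv 1 f (xz p)) =1 ev fz} ->
    U p -> is_derive p (delta_mx 0 2)
    (iter k (pderiv 0) f \o @xz R) (ev (iter k jet_dx fz) p).
  move=> sf fzE Up; rewrite -(pderiv_z_iter sf fzE k (mem_set Up)).
  case: Up => Dp _.
  have := @is_derive_xz R (iter k (pderiv 0) f) p (delta_mx 0 2).
  rewrite xz_delta_z; apply.
  exact: smooth_on_derivable (smooth_on_iter_pderiv _ _ sf) Dp.
move=> Up; apply: is_derive_jet_der; first by case: Up.
- by rewrite mxE.
- move=> k; apply: dzE => // q /set_mem[Dq _]; rewrite /ev /=.
  have := lE Dq; rewrite /jet_eval /=.
  move: (pderiv 1 l _) (pderiv 0 (pderiv 0 (pderiv 0 l)) _) (pderiv 0 l _) (l _).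
  by move=> lz lxxx lx l0 /eqP; rewrite addrC addr_eq0 => /eqP ->; ring.
- move=> k; apply: dzE => // q /set_mem[Dq _]; rewrite /ev /=.
  have := mE Dq; rewrite /jet_eval /=.
  move: (pderiv 1 m _) (pderiv 0 m _) (m _) (pderiv 0 l _) (l _).
  (* Adding the left-hand side of the second equation, which is 0, to [mz] cancels [mz]. *)
  by move=> mz mx m0 lx l0 mE0; rewrite -[mz]addr0 -mE0; ring.
Qed.

Lemma is_derive_jet_dy p e : U p ->
  is_derive p (delta_mx 0 1) (ev e) (ev (jet_dy e) p).
Proof.
(* [xz] sends the y-direction to 0, and the derivative along the zero vector always exists and is
   0. *)
have dyE (f : _ -> R) : is_derive p (delta_mx 0 1) (f \o @xz R) 0.
  have := @is_derive_xz R f p (delta_mx 0 1).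
  by rewrite xz_delta_y derive0; apply; exact: derivable0.
move=> Up; apply: is_derive_jet_der; first by case: Up.
- by rewrite mxE.
Qed.

Lemma pderiv_jet (i : 'I_3) p e : U p ->
  pderiv i (ev e) p = ev (jet_pderiv i e) p.
Proof.
move=> Up; rewrite /pderiv; case: i => -[|[|[|]]]// i3.
- by rewrite (_ : Ordinal i3 = 0); [case: (is_derive_jet_dx e Up)|exact/val_inj].
- by rewrite (_ : Ordinal i3 = 1); [case: (is_derive_jet_dy e Up)|exact/val_inj].
- by rewrite (_ : Ordinal i3 = 2); [case: (is_derive_jet_dz e Up)|exact/val_inj].
Qed.

End JetCalculus.

(** * Formal metric, connection and curvature *)

Definition jet_metric (i j : nat) : jet :=
  let gxz := Add (Mul (L 0) (Mul Y Y)) (M 0) in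
  let gzz := Add (Add (Add (Mul (Mul (L 0) (L 0)) (Mul Y Y))
      (Opp (Mul (Mul (Cst 2) (L 1)) Y)))
      (Mul (Mul (Cst 2) (L 0)) (M 0))) (Mul (Cst 2) (L 0)) in
  nth (Cst 0) (nth [::] [:: [:: Mul Y Y; Cst 0; gxz];
                            [:: Cst 0; Cst 0; Cst 1];
                            [:: gxz; Cst 1; gzz]] i) j.

(** The inverse of the metric matrix. The determinant is -y^2, so powers of y are the only
    denominators and [Yinv] suffices. *)
Definition jet_cometric (i j : nat) : jet :=
  let gxx := Mul Yinv Yinv in
  let gxy := Opp (Mul (jet_metric 0 2) gxx) in
  let gyy := Add (Mul (Mul (jet_metric 0 2) (jet_metric 0 2)) gxx)
                 (Opp (jet_metric 2 2)) in
  nth (Cst 0) (nth [::] [:: [:: gxx; gxy; Cst 0];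
                            [:: gxy; gyy; Cst 1];
                            [:: Cst 0; Cst 1; Cst 0]] i) j.

Definition jet_sum (F : nat -> jet) := Add (F 0) (Add (F 1) (F 2)).

Definition jet_christoffel1 a i j :=
  Mul (Add (Add (jet_pderiv i (jet_metric a j)) (jet_pderiv j (jet_metric a i)))
           (Opp (jet_pderiv a (jet_metric i j)))) Half.

Definition jet_christoffel k i j :=
  jet_sum (fun a => Mul (jet_cometric k a) (jet_christoffel1 a i j)).

Definition jet_riemann_up i j k l :=
  Add (Add (jet_pderiv k (jet_christoffel i l j))
           (Opp (jet_pderiv l (jet_christoffel i k j))))
      (jet_sum (fun a =>
         Add (Mul (jet_christoffel i k a) (jet_christoffel a l j))
             (Opp (Mul (jet_christoffel i l a) (jet_christoffel a k j))))).

(** * Evaluation of the formal metric and its inverse *)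

Section Evaluation.
Context {R : realType} (l m : 'rV[R]_2 -> R).

Lemma jet_evalD a b p :
  jet_eval l m (Add a b) p = jet_eval l m a p + jet_eval l m b p.
Proof. by []. Qed.

Lemma jet_evalN a p : jet_eval l m (Opp a) p = - jet_eval l m a p.
Proof. by []. Qed.

Lemma jet_eval_sum (F : nat -> jet) p :
  jet_eval l m (jet_sum F) p = \sum_(a < 3) jet_eval l m (F a) p.
Proof. by rewrite !big_ord_recl big_ord0 addr0. Qed.

Lemma jet_eval_metric (i j : 'I_3) (p : 'rV[R]_3) :
  kdv_metric l m p i j = jet_eval l m (jet_metric i j) p.
Proof.
by case: i j => -[|[|[|]]]// ? [[|[|[|]]]// ?]; rewrite mxE /jet_eval /= ?expr2.
Qed.

Lemma jet_eval_cometric (i j : 'I_3) (p : 'rV[R]_3) : p 0 1 != 0 ->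
  invmx (kdv_metric l m p) i j = jet_eval l m (jet_cometric i j) p.
Proof.
move=> y0; pose h := \matrix_(i < 3, j < 3) jet_eval l m (jet_cometric i j) p.
suff gh : kdv_metric l m p *m h = 1%:M.
  rewrite -[invmx _]mulmx1 -gh mulmxA mulVmx ?mul1mx ?mxE//.
  exact: kdv_metric_unit.
apply/matrixP => i' j'; rewrite mxE !big_ord_recl big_ord0 !jet_eval_metric !mxE.
rewrite /jet_eval; move: (p 0 1) (fun k => _ l _) (fun k => _ m _) y0 => y dl dm y0.
by case: i' j' => -[|[|[|]]]// ? [[|[|[|]]]// ?] /=; field.
Qed.

End Evaluation.

(** * The formal curvature evaluates to the curvature of the metric *)

Section JetCurvature.
Context {R : realType} {D : set 'rV[R]_2} {l m : 'rV[R]_2 -> R}.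
Context (oD : open D) (sl : smooth_on D l) (sm : smooth_on D m).
Context (lE : forall q, D q ->
  pderiv 0 (pderiv 0 (pderiv 0 l)) q - 3 * l q * pderiv 0 l q
  + pderiv 1 l q = 0).
Context (mE : forall q, D q ->
  pderiv 0 l q - pderiv 1 m q + 2 * pderiv 0 l q * m q
  + l q * pderiv 0 m q = 0).

Let U := [set p : 'rV[R]_3 | D (xz p) /\ p 0 1 != 0].
Let g := kdv_metric l m.
Let ev := jet_eval l m.

Lemma christoffel1_jet (a i j : 'I_3) p : U p ->
  christoffel1 g a i j p = ev (jet_christoffel1 a i j) p.
Proof.
move=> Up; rewrite /christoffel1.
have dgE (b c d : 'I_3) :
    pderiv d (fun q => g q b c) p = ev (jet_pderiv d (jet_metric b c)) p.
  rewrite /ev -(pderiv_jet oD sl sm lE mE) //; congr pderiv.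
  by apply/funext => q; exact: jet_eval_metric.
by rewrite !dgE.
Qed.

Lemma christoffel_jet (k i j : 'I_3) p : U p ->
  christoffel g k i j p = ev (jet_christoffel k i j) p.
Proof.
move=> Up; rewrite /ev jet_eval_sum; apply: eq_bigr => a _.
by rewrite christoffel1_jet// jet_eval_cometric//; case: Up.
Qed.

Lemma riemann_up_jet (i j k n : 'I_3) p : U p ->
  riemann_up g i j k n p = ev (jet_riemann_up i j k n) p.
Proof.
move=> Up; have oU := open_metric_domain oD.
(* Unlike the metric components, the Christoffel symbols are matched with their formal versions only
   on [U]; as [U] is open, this still determines their derivatives. *)
have dchrE (a b c d : 'I_3) :
    pderiv d (christoffel g a b c) p = ev (jet_pderiv d (jet_christoffel a b c)) p.
  rewrite /ev -(pderiv_jet oD sl sm lE mE) //; apply: eq_pderiv Up => // q /set_mem.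
  exact: christoffel_jet.
rewrite /riemann_up !dchrE /ev 2!jet_evalD jet_evalN jet_eval_sum; congr (_ + _).
by apply: eq_bigr => a _; rewrite !christoffel_jet.
Qed.

End JetCurvature.

(** * Vanishing of the curvature *)

(** The system is already built into [jet_dz], so each of the 81 components is a rational identity
    in y and free values of the derivatives. *)
Lemma jet_riemann_up_eq0 (R : realType) (l m : 'rV[R]_2 -> R) (i j k n : 'I_3)
    (p : 'rV[R]_3) :
  p 0 1 != 0 -> jet_eval l m (jet_riemann_up i j k n) p = 0.
Proof.
(* With opaque atoms for the derivatives, field does not try to unify them. *)
rewrite /jet_eval; move: (p 0 1) (fun k => _ l _) (fun k => _ m _) => y dl dm y0.
case: i j k n => -[|[|[|]]]// ? [[|[|[|]]]// ?] [[|[|[|]]]// ?] [[|[|[|]]]// ?].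
all: cbn [nat_of_ord].
(* With concrete indices [e] is a closed term: all formal derivatives are computed before [jet_val]
   turns the result into a field expression. *)
all: match goal with |- jet_val _ _ _ ?e = 0 =>
  let e' := eval vm_compute in e in change e with e' end.
all: cbn [jet_val].
all: by field.
Qed.

Theorem theorem1 (R : realType) (D : set 'rV[R]_2) (l m : 'rV[R]_2 -> R) :
  open D -> smooth_on D l -> smooth_on D m ->
  (forall q, D q ->
     pderiv 0 (pderiv 0 (pderiv 0 l)) q - 3 * l q * pderiv 0 l q
     + pderiv 1 l q = 0) ->
  (forall q, D q ->
     pderiv 0 l q - pderiv 1 m q + 2 * pderiv 0 l q * m q
     + l q * pderiv 0 m q = 0) ->
  flat_on [set p | D (xz p) /\ p 0 1 != 0] (kdv_metric l m).
Proof.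
move=> oD sl sm lE mE p Up i j k n; rewrite /riemann big1// => a _.
rewrite (riemann_up_jet oD sl sm lE mE _ _ _ _ Up) jet_riemann_up_eq0 ?mulr0//.
by case: Up.
Qed.
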